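(* Let $G$ be the group of complex points of a (possibly disconnected) reductive algebraic group. If $\Gamma$ is a finitely generated nilpotent group which surjects onto a finite non-abelian subgroup of $G$, then $\operatorname{Hom}(\Gamma,G)$ and $\operatorname{Hom}(\Gamma,G)/\!\!/G$ are both disconnected topological spaces.
   Context: Reductive algebraic groups are affine algebraic groups over $\mathbb{C}$, and $G$ carries its Hausdorff (analytic) topology. For a finitely generated group $\Gamma$, $\operatorname{Hom}(\Gamma,G)$ is the set of all group homomorphisms $\Gamma\to G$. It is identified, via the images of a finite generating set of $r$ elements, with an affine algebraic subset of $G^r$, and it carries the induced Hausdorff (analytic) topology, which does not depend on the generating set. $G$ acts on $\operatorname{Hom}(\Gamma,G)$ by conjugation, and $\operatorname{Hom}(\Gamma,G)/\!\!/G$ (the character variety) is the affine geometric invariant theory quotient with its Hausdorff (analytic) topology; topologically it is the universal quotient of $\operatorname{Hom}(\Gamma,G)$ by $G$ in the category of Hausdorff spaces. *)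

(* Defs.v *)
From HB Require Import structures.
From mathcomp Require Import all_boot all_order all_algebra.
From mathcomp Require Import all_classical all_reals all_analysis.
From mathcomp Require Import complex.
From mathcomp Require mpoly.
(* The notations of mpoly clash with those of MathComp-Analysis, hence
   [mpoly n K] for polynomials in n variables and [meval v p] for p(v). *)
Import -(notations) mpoly.
Import numFieldNormedType.Exports.

Set Implicit Arguments.
Unset Strict Implicit.
Unset Printing Implicit Defensive.

Local Open Scope classical_set_scope.
Local Open Scope ring_scope.

(* Ascribed to numClosedFieldType so that the topology of the norm (the usual
   topology of the complex plane) is inferred, also on row vectors. *)
Definition Cplx (R : realType) : numClosedFieldType := R[i].

Section AbstractGroups.
Variable G : groupType.
Implicit Types A H : set G.

Definition subgroup H : Prop := group_closed (mem H).

Definition generated A : set G := smallest subgroup A.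

Definition normal_subgroup H : Prop :=
  subgroup H /\ forall x g, H x -> H (x ^ g)%g.

Definition abelian_subset H : Prop :=
  forall x y, H x -> H y -> commute x y.

Fixpoint lower_central (k : nat) : set G :=
  if k is k'.+1 then
    generated [set z | exists x y, lower_central k' x /\ z = [~ x, y]%g]
  else setT.

Definition nilpotent_group : Prop := exists c, lower_central c = [set 1%g].

End AbstractGroups.

Section AffineSpace.
Variable R : realType.
Local Notation C := (Cplx R).

Definition peval n (p : mpoly n C) (v : 'rV[C]_n) : C := meval (v 0) p.

Definition zariski_closed n (X : set 'rV[C]_n) : Prop :=
  exists S : set (mpoly n C), X = [set v | forall p, S p -> peval p v = 0].

(* f is a polynomial function of the coordinates c on T *)
Definition regular (T : Type) n (c : T -> 'rV[C]_n) (f : T -> C) : Prop :=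
  exists p : mpoly n C, forall t, f t = peval p (c t).

End AffineSpace.

(* The structure of an affine algebraic group over the complex numbers on the
   abstract group G of its complex points: a bijection of G with a Zariski
   closed subset of an affine space for which the group laws are polynomial.
   No connectedness or irreducibility is assumed. *)
Record algebraic_group (R : realType) (G : groupType) := AlgebraicGroup {
  adim : nat;
  coords : G -> 'rV[Cplx R]_adim;
  coords_inj : injective coords;
  coords_closed : zariski_closed (range coords);
  mul_regular : forall j : 'I_adim,
    regular (fun xy : G * G => row_mx (coords xy.1) (coords xy.2))
            (fun xy => coords (xy.1 * xy.2)%g 0 j);
  inv_regular : forall j : 'I_adim,
    regular coords (fun x => coords x^-1%g 0 j)
}.

Section Reductive.
Variables (R : realType) (G : groupType) (aG : algebraic_group R G).
Local Notation C := (Cplx R).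

Definition closed_in (A : set G) : Prop := zariski_closed (coords aG @` A).

Definition zariski_connected (A : set G) : Prop :=
  forall B D : set G, closed_in B -> closed_in D ->
    A `<=` B `|` D -> A `&` B `&` D = set0 -> A `<=` B \/ A `<=` D.

Definition rational_representation m (rho : G -> 'M[C]_m) : Prop :=
  [/\ rho 1%g = 1%:M,
      forall x y, rho (x * y)%g = rho x *m rho y
    & forall i j, regular (coords aG) (fun x => rho x i j)].

(* intrinsic, i.e. independent of the choice of a faithful representation *)
Definition unipotent (u : G) : Prop :=
  forall m (rho : G -> 'M[C]_m), rational_representation rho ->
    exists k : nat, (rho u - 1%:M) ^+ k = 0.

(* The unipotent radical, i.e. the largest closed connected normal subgroup
   of G consisting of unipotent elements, is trivial. *)
Definition reductive : Prop :=
  forall U : set G, normal_subgroup U -> closed_in U -> zariski_connected U ->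
    (forall u, U u -> unipotent u) -> U = [set 1%g].

End Reductive.

Section Conjugation.
Variables (Gamma G : groupType) (g : G) (phi : {multiplicative Gamma -> G}).

Definition conj_fun (x : Gamma) : G := (g * phi x * g^-1)%g.

Fact conj_fun_multiplicative : {morph conj_fun : x y / (x * y)%g}.
Proof. by move=> x y; rewrite /conj_fun gmulfM !mulgA mulgVK. Qed.

HB.instance Definition _ :=
  isMultiplicative.Build Gamma G conj_fun conj_fun_multiplicative.

Definition conj_hom : {multiplicative Gamma -> G} := conj_fun.

End Conjugation.

Section HomVariety.
Variables (R : realType) (G : groupType) (aG : algebraic_group R G).
Variables (Gamma : groupType) (r : nat) (s : 'I_r -> Gamma).
Local Notation C := (Cplx R).
Local Notation Hom := {multiplicative Gamma -> G}.

(* (phi (s 0), ..., phi (s (r - 1))), a point of G^r in the affine space of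
   dimension r * adim aG *)
Definition hom_coords (phi : Hom) : 'rV[C]_(r * adim aG) :=
  mxvec (\matrix_(i, j) coords aG (phi (s i)) 0 j).

(* Hom(Gamma, G) as a subset of the affine space, when s generates Gamma *)
Definition hom_variety : set 'rV[C]_(r * adim aG) := range hom_coords.

Definition invariant_regular (f : Hom -> C) : Prop :=
  regular hom_coords f /\ forall g phi, f (conj_hom g phi) = f phi.

Definition invariant_ring := {f : Hom -> C | invariant_regular f}.

(* The complex points of the spectrum of the ring of invariants: its
   homomorphisms of C-algebras to C. They carry the topology of pointwise
   convergence, which is the topology induced by the closed embedding in an
   affine space given by any finite set of generators of the ring. *)
Definition git_quotient : set {ptws invariant_ring -> C} :=
  [set chi |
    [/\ forall a b c : invariant_ring,
          (forall phi, sval c phi = sval a phi + sval b phi) ->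
          chi c = chi a + chi b,
        forall a b c : invariant_ring,
          (forall phi, sval c phi = sval a phi * sval b phi) ->
          chi c = chi a * chi b
      & forall (z : C) (c : invariant_ring),
          (forall phi, sval c phi = z) -> chi c = z]].

End HomVariety.

Arguments hom_coords {R G} aG {Gamma r} s phi.
Arguments hom_variety {R G} aG {Gamma r} s.
Arguments invariant_regular {R G} aG {Gamma r} s f.
Arguments invariant_ring {R G} aG {Gamma r} s.
Arguments git_quotient {R G} aG {Gamma r} s.

(* Main.v *)
Require Import Defs.
From mathcomp Require Import all_boot all_order all_algebra.
From mathcomp Require Import separable cyclotomic mxrepresentation.
From mathcomp Require Import all_classical all_reals all_analysis.
From mathcomp Require mpoly.
Import -(notations) mpoly.
Import numFieldNormedType.Exports.

(** The theorem is detected by a single function, the trace of the image of a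
    commutator.

    Let rho be a faithful rational representation of G of dimension k, let g be
    an element of the commutator subgroup of Gamma, and put
    f(phi) = tr (rho (phi g)).  This is a regular function on Hom(Gamma, G),
    invariant under conjugation.  It takes only finitely many values: every
    phi makes C^k a representation X of the nilpotent group Gamma, and the
    eigenvalues of X(g) are roots of unity of an order that depends only on k
    and on the nilpotency class ([eigenvalue_unity]), so that its trace lies in
    a finite set independent of phi ([trace_commutator_finite]).  A continuous
    function with finitely many values that is not constant disconnects its
    domain ([disconnected_finite_valued]).

    On the trivial homomorphism f equals k.  If phi has a finite non-abelian
    image, choose for g a commutator with phi g <> 1; the matrix rho (phi g) has
    finite order and is not the identity, so it is diagonalizable with
    eigenvalues of modulus 1 that are not all equal to 1, and its trace is not
    k ([trace_finite_order]).  Hence f is not constant and Hom(Gamma, G) is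
    disconnected.

    The same function disconnects the quotient, whose points are the characters
    chi of the ring of invariants: f is a root of a polynomial with finitely
    many roots, and chi, being a morphism of algebras, sends f to one of these
    roots ([git_quotient_spectrum]); evaluations at homomorphisms provide two
    characters with different values.

    The bound on the eigenvalues is reduced to irreducible representations by
    passing to invariant subspaces and quotients.  When X is irreducible of
    dimension d, an element z with X(z) scalar that lies in the commutator
    subgroup has determinant 1, so X(z)^d = 1.  Consequently, if x commutes with
    all of Gamma up to elements acting as scalars, these scalars are d-th roots
    of unity, x^d commutes with Gamma in the representation, and X(x^d) is a
    scalar by Schur's lemma.  Climbing the upper central series of Gamma modulo
    the scalars, the power d^c of every element acts as a scalar, where c is the
    nilpotency class ([expg_nilpotent]).

    A faithful representation exists by the usual finiteness of the space of
    translates of the coordinate functions, obtained here from a maximal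
    nonzero minor of the infinite matrix (x, (y, j)) |-> (x y)_j
    ([faithful_representation]). *)

Set Implicit Arguments.
Unset Strict Implicit.
Unset Printing Implicit Defensive.

Import Order.TTheory GRing.Theory Num.Theory.

Local Open Scope classical_set_scope.
Local Open Scope ring_scope.

(** * Iterated centers modulo a normal subgroup *)

Section Groups.
Variable Gamma : groupType.
Implicit Types (H P : set Gamma) (x y : Gamma).

(** For P normal, the preimage in Gamma of the center of Gamma / P.  Iterating
    it from P gives the upper central series above P, without forming
    quotient groups. *)
Definition centralizing_modulo P : set Gamma := [set x | forall y, P [~ x, y]%g].

Lemma normal_subgroupP P : normal_subgroup P <->
  [/\ P 1%g, forall x y, P x -> P y -> P (x * y)%g,
      forall x, P x -> P x^-1%g & forall x g, P x -> P (x ^ g)%g].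
Proof.
split=> [[subP nP]|[P1 PM PV PJ]].
  have PV := group_closedV subP; have PM := group_closedM subP.
  split=> //; first by case: subP => /set_mem.
  - by move=> x y /mem_set Px /mem_set Py; exact/set_mem/PM.
  - by move=> x /mem_set Px; exact/set_mem/PV.
split=> //; split; first exact: mem_set.
by move=> x y /set_mem Px /set_mem Py; apply/mem_set/PM => //; exact: PV.
Qed.

Lemma normal_centralizing_modulo P :
  normal_subgroup P -> normal_subgroup (centralizing_modulo P).
Proof.
move=> /normal_subgroupP[P1 PM PV PJ]; apply/normal_subgroupP; split.
- by move=> y; rewrite comm1g.
- move=> x y Px Py z.
  have -> : [~ x * y, z]%g = ([~ x, z] ^ y * [~ y, z])%g.
    by rewrite !commgEl !conjgE !invgM !mulgA !mulgK.
  by apply: PM; [exact/PJ/Px|exact: Py].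
- move=> x Px z.
  have -> : [~ x^-1, z]%g = ([~ x, z]^-1 ^ x^-1)%g.
    by rewrite !commgEl !conjgE !invgM !invgK !mulgA mulgK.
  by apply/PJ/PV/Px.
- move=> x g Px z; have := PJ _ g (Px (z ^ g^-1)%g).
  by rewrite conjRg conjgKV.
Qed.

(** The k-th step of the upper central series above P contains the lower central
    series k steps before it enters P. *)
Lemma lower_central_sub_centralizing P c k :
  normal_subgroup P -> lower_central c `<=` P ->
  lower_central (c - k) `<=` iter k centralizing_modulo P.
Proof.
move=> nP cP; elim: k => [|k IHk]; first by rewrite subn0.
have [ck|kc] := leqP c k.
  move=> x _ y; apply: IHk.
  by have -> : (c - k = 0)%N by apply/eqP; rewrite subn_eq0.
move=> x lx y; apply: IHk.
have -> : (c - k = (c - k.+1).+1)%N by rewrite subnS prednK // subn_gt0.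
by apply: sub_gen_smallest; exists x, y.
Qed.

Lemma normal_iter_centralizing P k :
  normal_subgroup P -> normal_subgroup (iter k centralizing_modulo P).
Proof. by move=> nP; elim: k => //= k; exact: normal_centralizing_modulo. Qed.

(** Since u is central modulo P, the factors u can be collected to the right of
    the factors x, each exchange costing a commutator in P. *)
Lemma expMg_centralizing P x u n :
  normal_subgroup P -> centralizing_modulo P u ->
  exists2 z, P z & ((x * u) ^+ n = x ^+ n * u ^+ n * z)%g.
Proof.
move=> nP Zu; have /normal_subgroupP[P1 PM PV PJ] := nP.
have /normal_subgroupP[Z1 ZM ZV ZJ] := normal_centralizing_modulo nP.
have ZX m : centralizing_modulo P (u ^+ m)%g.
  by elim: m => [|m IHm]; rewrite ?expg0 // expgS; exact: ZM.
elim: n => [|n [z Pz IHn]]; first by exists 1%g; rewrite // !expg0 !mulg1.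
(* x^n u^n z x u = x^n x u^n [u^n, x] z^x u *)
exists (([~ u ^+ n, x] * z ^ x) ^ u)%g.
  by apply/PJ/PM; [exact: ZX|exact: PJ].
by rewrite !expgSr IHn !commgEl !conjgE !mulgA !(mulgK, mulgVK).
Qed.

(** If d-th powers lower the first step of the upper central series above P,
    they lower all of them: for x in step k + 2 and any y, the commutator
    [x, y] lies in step k + 1 and x ^ y = x [x, y], so [x^d, y] agrees with
    [x, y]^d up to step k, to which the induction hypothesis sends [x, y]^d. *)
Lemma expg_centralizing P d :
  normal_subgroup P ->
  (forall x, centralizing_modulo P x -> P (x ^+ d)%g) ->
  forall k x, iter k.+1 centralizing_modulo P x ->
    iter k centralizing_modulo P (x ^+ d)%g.
Proof.
move=> nP Pd; elim=> [|k IHk] x Zx; first exact: Pd.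
have nQ := normal_iter_centralizing k nP.
have /normal_subgroupP[Q1 QM QV QJ] := nQ.
move=> y; rewrite commgEl conjXg.
have -> : (x ^ y = x * [~ x, y])%g by rewrite commgEl mulVKg.
have [z Qz ->] := expMg_centralizing x d nQ (Zx y).
rewrite !mulgA mulVg mul1g; apply: QM => //; apply: IHk; exact: Zx.
Qed.

(** By nilpotency, step c of the upper central series above P is all of Gamma,
    and each d-th power descends by one step. *)
Lemma expg_nilpotent P d c :
  normal_subgroup P ->
  (forall x, centralizing_modulo P x -> P (x ^+ d)%g) ->
  lower_central c = [set 1%g : Gamma] ->
  forall x, P (x ^+ (d ^ c))%g.
Proof.
move=> nP Pd lc x.
have : iter c centralizing_modulo P x.
  apply: (@lower_central_sub_centralizing P c) => //; last by rewrite subnn.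
  by have /normal_subgroupP[P1 _ _ _] := nP; rewrite lc => _ ->.
elim: c {lc} x => [|c IHc] x Px; first by rewrite expn0.
rewrite expnS expgnA; apply: IHc; exact: expg_centralizing.
Qed.

Lemma subgroup_generated (A : set Gamma) : subgroup (generated A).
Proof.
split; first by apply/mem_set => H [[/set_mem]].
move=> x y /set_mem gx /set_mem gy; apply/mem_set => H /[dup] HA [[_ HV] _].
by apply/set_mem/HV; apply/mem_set; [exact: gx|exact: gy].
Qed.

Lemma subgroupX (H : set Gamma) x k : subgroup H -> H x -> H (x ^+ k)%g.
Proof.
move=> sH Hx; elim: k => [|k IHk]; first by case: sH => /set_mem.
rewrite expgS; apply/set_mem; apply: (group_closedM sH); exact: mem_set.
Qed.

End Groups.

(** * Matrix representations of nilpotent groups *)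

Section MatrixReps.
Variables (F : closedFieldType) (Gamma : groupType).

Definition mx_rep n (X : Gamma -> 'M[F]_n) : Prop :=
  X 1%g = 1%:M /\ forall x y, X (x * y)%g = X x *m X y.

Lemma mx_repV n (X : Gamma -> 'M[F]_n) x : mx_rep X -> X x *m X x^-1%g = 1%:M.
Proof. by case=> X1 XM; rewrite -XM mulgV. Qed.

Lemma mx_repVl n (X : Gamma -> 'M[F]_n) x : mx_rep X -> X x^-1%g *m X x = 1%:M.
Proof. by case=> X1 XM; rewrite -XM mulVg. Qed.

Lemma mx_rep_unit n (X : Gamma -> 'M[F]_n) x : mx_rep X -> X x \in unitmx.
Proof. by move=> /(mx_repV x)/mulmx1_unit[]. Qed.

Lemma det_commutator n (X : Gamma -> 'M[F]_n) g :
  mx_rep X -> lower_central 1 g -> \det (X g) = 1.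
Proof.
move=> repX; have [X1 XM] := repX.
have uX x : \det (X x) != 0 by rewrite -unitfE -unitmxE mx_rep_unit.
have detV x : \det (X x^-1%g) = (\det (X x))^-1.
  have := congr1 determinant (mx_repV x repX); rewrite det_mulmx det1 => dV.
  by apply: (mulfI (uX x)); rewrite divff.
move: g; apply: smallest_sub => [|_ [x [y [_ ->]]]] /=.
  split; first by apply/mem_set; rewrite /= X1 det1.
  move=> x y /set_mem /= dx /set_mem /= dy; apply/mem_set => /=.
  by rewrite XM det_mulmx detV dx dy divr1.
rewrite commgEl conjgE !XM !det_mulmx !detV.
by rewrite [\det (X x) * _]mulrC mulKf // mulVf.
Qed.

(** The representation acts on row vectors, so that invariant subspaces are row
    spaces; the zero representation counts as irreducible. *)
Definition irreducible n (X : Gamma -> 'M[F]_n) : Prop :=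
  forall U : 'M[F]_n, (forall g, (U *m X g <= U)%MS) -> U = 0 \/ row_full U.

Lemma closed_eigenvalue n (A : 'M[F]_n) : (0 < n)%N ->
  exists a, exists2 v : 'rV[F]_n, v *m A = a *: v & v != 0.
Proof.
move=> n0; have : size (char_poly A) != 1%N.
  by rewrite size_char_poly eqSS -lt0n.
move=> /closed_rootP[a]; rewrite -eigenvalue_root_char => /eigenvalueP[v].
by exists a, v.
Qed.

(** The eigenspaces of A are invariant, and A has one since F is algebraically
    closed. *)
Lemma schur n (X : Gamma -> 'M[F]_n) (A : 'M[F]_n) :
  irreducible X -> (forall g, A *m X g = X g *m A) -> is_scalar_mx A.
Proof.
case: n X A => [|n] X A irr cA.
  by apply/is_scalar_mxP; exists 0; rewrite [A]flatmx0 [RHS]flatmx0.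
have [a [v va v0]] := closed_eigenvalue A (ltn0Sn n).
have [g||full] := irr (eigenspace A a).
- apply/eigenspaceP; rewrite -mulmxA -cA mulmxA.
  by have /eigenspaceP -> := submx_refl (eigenspace A a); rewrite -scalemxAl.
- move=> E0; have := introT eigenspaceP va.
  by rewrite E0 submx0 (negPf v0).
- apply/is_scalar_mxP; exists a.
  have /eigenspaceP := submx_full 1%:M full.
  by rewrite mul1mx scalemx1.
Qed.

Lemma normal_scalar n (X : Gamma -> 'M[F]_n) : mx_rep X ->
  normal_subgroup [set x | is_scalar_mx (X x)].
Proof.
move=> repX; have [X1 XM] := repX; apply/normal_subgroupP; split => /=.
- by rewrite X1; exact: scalar_mx_is_scalar.
- move=> x y /is_scalar_mxP[a xa] /is_scalar_mxP[b yb].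
  by rewrite XM xa yb -scalar_mxM; exact: scalar_mx_is_scalar.
- move=> x /is_scalar_mxP[a xa].
  have := mx_repV x repX; rewrite xa mul_scalar_mx => aV.
  (* X x is invertible, so a = 0 only in dimension 0. *)
  have [a0|a0] := eqVneq a 0.
    move: aV; rewrite a0 scale0r => /(congr1 (mulmx^~ (X x^-1%g))).
    by rewrite mul0mx mul1mx => <-; apply/is_scalar_mxP; exists 0; rewrite raddf0.
  apply/is_scalar_mxP; exists a^-1.
  by rewrite -[LHS]scale1r -(mulVf a0) -scalerA aV scalemx1.
- move=> x g /is_scalar_mxP[a xa].
  rewrite conjgE !XM xa -scalar_mxC mulmxA mx_repVl // mul1mx.
  exact: scalar_mx_is_scalar.
Qed.

Lemma mx_repX n (X : Gamma -> 'M[F]_n) x k : mx_rep X -> X (x ^+ k)%g = X x ^+ k.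
Proof.
move=> [X1 XM]; elim: k => [|k IHk]; first by rewrite expg0 expr0.
by rewrite expgS XM IHk exprS.
Qed.

(** The determinant of X g is 1 because g is a product of commutators; for a
    scalar matrix a it is a ^ n. *)
Lemma scalar_commutator n (X : Gamma -> 'M[F]_n) g :
  mx_rep X -> lower_central 1 g -> is_scalar_mx (X g) -> X g ^+ n = 1.
Proof.
move=> repX lg /is_scalar_mxP[a ga].
have := det_commutator repX lg; rewrite ga det_scalar => an.
by rewrite -rmorphXn an.
Qed.

(** The descent of [expg_nilpotent] applies with P the preimage of the scalars
    and d = n: if [x, y] acts as a scalar for all y, this scalar has n-th
    power 1, so x^n commutes with every y in the representation and acts as a
    scalar by [schur].  Thus g^(n^c) acts as a scalar, and the last factor n of
    the exponent comes from [scalar_commutator]. *)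
Lemma irreducible_exponent n (X : Gamma -> 'M[F]_n) c g :
  mx_rep X -> irreducible X -> lower_central c = [set 1%g : Gamma] ->
  lower_central 1 g -> X g ^+ (n ^ c.+1) = 1.
Proof.
move=> repX irr lc lg; have [X1 XM] := repX.
have Zscal := normal_scalar repX.
rewrite expnSr exprM -mx_repX //; apply: scalar_commutator => //.
  exact: (@subgroupX _ (lower_central 1) g _ (subgroup_generated _) lg).
apply: (expg_nilpotent Zscal _ lc g) => {lg} x Zx /=.
apply: schur irr _ => y; rewrite -!XM conjgC XM conjXg.
have -> : (x ^ y = x * [~ x, y])%g by rewrite commgEl mulVKg.
have /is_scalar_mxP[a xya] := Zx y.
have lxy : lower_central 1 [~ x, y]%g by apply: sub_gen_smallest; exists x, y.
have := scalar_commutator repX lxy (Zx y).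
rewrite !mx_repX // XM xya mulmxE exprMn_comm; last exact: scalar_mxC.
by move=> ->; rewrite mulr1 XM mx_repX.
Qed.

Lemma irreducible_or_invariant n (X : Gamma -> 'M[F]_n) :
  irreducible X \/ exists U : 'M[F]_n,
    [/\ (forall g, U *m X g <= U)%MS, (0 < \rank U)%N & (\rank U < n)%N].
Proof.
have [irr|/existsNP[U /not_implyP[UX /not_orP[U0 Uf]]]] := pselect (irreducible X).
  by left.
right; exists U; split=> //; first by rewrite lt0n mxrank_eq0; exact/eqP.
by rewrite ltn_neqAle rank_leq_col andbT; exact/negP.
Qed.

Section SubQuotient.
Variables (n : nat) (X : Gamma -> 'M[F]_n) (U : 'M[F]_n).
Hypotheses (repX : mx_rep X) (UX : forall g, (U *m X g <= U)%MS).

Definition sub_rep g := in_submod U (@val_submod _ _ U (\rank U) 1%:M *m X g).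
Definition quotient_rep g :=
  in_factmod U (@val_factmod _ _ U (\rank (cokermx U)) 1%:M *m X g).

Lemma invariant_sub m (W : 'M[F]_(m, n)) g : (W <= U)%MS -> (W *m X g <= U)%MS.
Proof. by move=> WU; apply: submx_trans (submxMr _ WU) (UX g). Qed.

Lemma in_submod_sub_rep m (W : 'M[F]_(m, n)) g :
  (W <= U)%MS -> in_submod U (W *m X g) = in_submod U W *m sub_rep g.
Proof.
move=> WU; rewrite mulmxA; congr (in_submod _).
by rewrite mulmxA -val_submodE in_submodK.
Qed.

Lemma in_factmod_quotient_rep m (W : 'M[F]_(m, n)) g :
  in_factmod U (W *m X g) = in_factmod U W *m quotient_rep g.
Proof.
rewrite -{1}[W](add_sub_fact_mod U) mulmxDl linearD /=.
have /eqP -> : in_factmod U (val_submod (in_submod U W) *m X g) == 0.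
  by rewrite in_factmod_eq0 invariant_sub ?val_submodP.
by rewrite add0r /in_factmod /val_factmod /= !mulmxA mulmx1.
Qed.

Lemma mx_rep_sub : mx_rep sub_rep.
Proof.
case: repX => X1 XM; split=> [|x y]; rewrite /sub_rep ?X1 ?mulmx1 ?val_submodK //.
by rewrite XM mulmxA in_submod_sub_rep // invariant_sub ?val_submodP.
Qed.

Lemma mx_rep_quotient : mx_rep quotient_rep.
Proof.
case: repX => X1 XM; split=> [|x y].
  by rewrite /quotient_rep X1 mulmx1 val_factmodK.
by rewrite /quotient_rep XM mulmxA in_factmod_quotient_rep.
Qed.

End SubQuotient.

(** By induction on the dimension: an eigenvector either lies in an invariant
    subspace or has a nonzero image in the quotient by it.  An irreducible
    representation of dimension n <= m gives the exponent n ^ c.+1, which divides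
    m`! ^ c.+1; the factorial makes the exponent independent of n. *)
Lemma eigenvalue_unity m c n (X : Gamma -> 'M[F]_n) g a (v : 'rV[F]_n) :
  (n <= m)%N -> mx_rep X -> lower_central c = [set 1%g : Gamma] ->
  lower_central 1 g -> v *m X g = a *: v -> v != 0 -> a ^+ (m`! ^ c.+1) = 1.
Proof.
move=> nm repX lc lg; elim/ltn_ind: n => n IHn in X v nm repX *.
have [irr|[U [UX U0 Un]]] := irreducible_or_invariant X.
  move=> va v0.
  have n0 : (0 < n)%N.
    by case: n v v0 {va IHn X nm repX irr} => // v; rewrite thinmx0 eqxx.
  have vX k : v *m X g ^+ k = a ^+ k *: v.
    elim: k => [|k IHk]; first by rewrite !expr0 mulmx1 scale1r.
    by rewrite exprSr -mulmxE mulmxA IHk -scalemxAl va scalerA -exprSr.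
  have an : a ^+ (n ^ c.+1) = 1.
    have := vX (n ^ c.+1)%N.
    rewrite (irreducible_exponent repX irr lc lg) mulmx1 => /esym/eqP.
    rewrite -[X in _ == X]scale1r -subr_eq0 -scalerBl scaler_eq0 (negPf v0) orbF.
    by rewrite subr_eq0 => /eqP.
  have /dvdnP[q ->] : (n ^ c.+1 %| m`! ^ c.+1)%N.
    by apply: dvdn_exp2r; apply: dvdn_fact; rewrite n0.
  by rewrite mulnC exprM an expr1n.
move=> va v0; have [vU|vU] := boolP (v <= U)%MS.
  apply: (IHn _ Un (sub_rep X U) (in_submod U v)).
  - exact: leq_trans (ltnW Un) nm.
  - exact: mx_rep_sub.
  - by rewrite -in_submod_sub_rep // va linearZ.
  - by rewrite -(val_submod_eq0 (in_submod U v)) in_submodK.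
have rankn : (\rank (cokermx U) < n)%N.
  by rewrite mxrank_coker ltn_subrL U0 (leq_trans U0 (ltnW Un)).
apply: (IHn _ rankn (quotient_rep X U) (in_factmod U v)).
- exact: leq_trans (ltnW rankn) nm.
- exact: mx_rep_quotient.
- by rewrite -in_factmod_quotient_rep // va linearZ.
- by rewrite in_factmod_eq0.
Qed.

(** * Traces of matrices with eigenvalues of finite order *)

Lemma trace_sum_roots n (A : 'M[F]_n) :
  exists r : n.-tuple F, \tr A = \sum_(z <- r) z /\ {in r, forall z, eigenvalue A z}.
Proof.
have [r] := closed_field_poly_normal (char_poly A).
rewrite (monicP (char_poly_monic A)) scale1r => rA.
have /eqP sr : size r = n.
  by apply/eq_add_S; rewrite -(size_char_poly A) rA size_prod_XsubC.
exists (Tuple sr); split => /=; last first.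
  by move=> z zr; rewrite eigenvalue_root_char rA root_prod_XsubC.
case: n A rA sr => [|n] A rA sr.
  by rewrite (size0nil (eqP sr)) big_nil /mxtrace big_ord0.
apply/oppr_inj; rewrite -char_poly_trace // rA.
have := @coefPn_prod_XsubC F r; rewrite (eqP sr) => -> //.
Qed.

Lemma trace_unity_finite n N : (0 < N)%N ->
  exists T : seq F, forall A : 'M[F]_n,
    (forall a, eigenvalue A a -> a ^+ N = 1) -> \tr A \in T.
Proof.
move=> N0; have [rs] := closed_field_poly_normal ('X^N - 1%:P : {poly F}).
rewrite lead_coefXnsubC // scale1r => Nrs.
exists [seq \sum_(i < n) nth 0 rs (f i) | f : {ffun 'I_n -> 'I_(size rs)}] => A AN.
have [r [-> rA]] := trace_sum_roots A.
have r_rs z : z \in r -> z \in rs.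
  move=> /rA/AN zN; rewrite -root_prod_XsubC -Nrs rootE !hornerE.
  by rewrite zN subrr.
have idx (i : 'I_n) : (index (tnth r i) rs < size rs)%N.
  by rewrite index_mem r_rs // mem_tnth.
apply/mapP; exists [ffun i => Ordinal (idx i)]; first by rewrite mem_enum.
rewrite big_tuple; apply: eq_bigr => i _.
by rewrite ffunE /= nth_index // r_rs // mem_tnth.
Qed.

Lemma trace_commutator_finite n c g :
  lower_central c = [set 1%g : Gamma] -> lower_central 1 g ->
  exists T : seq F, forall X : Gamma -> 'M[F]_n, mx_rep X -> \tr (X g) \in T.
Proof.
move=> lc lg.
have N0 : (0 < n`! ^ c.+1)%N by rewrite expn_gt0 fact_gt0.
have [T TP] := trace_unity_finite n N0.
exists T => X repX; apply: TP => a /eigenvalueP[v va v0].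
exact: (eigenvalue_unity (leqnn n) repX lc lg va v0).
Qed.

End MatrixReps.

(** A is diagonalizable, being annihilated by the separable polynomial X^N - 1,
    with n eigenvalues of modulus 1.  Their sum can only be n if all of them
    are 1. *)
Lemma trace_finite_order (C : numClosedFieldType) n (A : 'M[C]_n) N :
  (0 < N)%N -> A ^+ N = 1 -> \tr A = n%:R -> A = 1%:M.
Proof.
case: n A => [|n] A N0; first by move=> *; rewrite [A]flatmx0 [RHS]flatmx0.
move=> AN trA.
have [rs] := closed_field_poly_normal ('X^N - 1%:P : {poly C}).
rewrite lead_coefXnsubC // scale1r => Nrs.
have [|P Pu] := (mxpoly.diagonalizableP A).2 _.
  exists rs; last first.
    rewrite -Nrs mxminpoly_min // rmorphB /= rmorphXn /= horner_mx_X horner_mx_C AN.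
    exact: subrr.
  rewrite -separable_prod_XsubC -Nrs; apply: separable_Xn_sub_1.
  by rewrite pnatr_eq0 -lt0n.
move=> /mxpoly.diagonalizable_forPex[D /(mxpoly.simmxP Pu) PA].
have PAk k : P *m A ^+ k = diag_mx D ^+ k *m P.
  elim: k => [|k IHk]; first by rewrite !expr0 mul1mx mulmx1.
  by rewrite exprSr exprS -!mulmxE mulmxA IHk -mulmxA PA mulmxA mulmxE -exprSr -exprS.
have DN i : D 0 i ^+ N = 1.
  have : horner_mx (diag_mx D) 'X^N = 1%:M.
    rewrite rmorphXn /= horner_mx_X -[LHS](mulmxK Pu).
    by rewrite -PAk AN mulmx1 mulmxV.
  by rewrite horner_mx_diag => /matrixP/(_ i i); rewrite !mxE eqxx hornerXn.
have trD : \sum_i D 0 i = \sum_(i < n.+1) 1.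
  rewrite -mxtrace_diag sumr_const card_ord -trA -[A]mul1mx -(mulVmx Pu).
  by rewrite -mulmxA PA mxtrace_mulC -mulmxA mulmxV // mulmx1.
have D1 : diag_mx D = 1%:M.
  rewrite -diag_const_mx; congr diag_mx; apply/rowP => i; rewrite mxE.
  apply: (normC_sum_upper _ trD) => // j _.
  by rewrite -(expr_le1 N0) // -normrX DN normr1.
by rewrite -[A]mul1mx -(mulVmx Pu) -mulmxA PA D1 mul1mx mulVmx.
Qed.

(** * Regular functions *)

Section Regular.
Variable R : realType.
Local Notation C := (Cplx R).

Section RegularOps.
Variables (T : Type) (n : nat) (c : T -> 'rV[C]_n).

Lemma regular_cst (z : C) : regular c (fun=> z).
Proof. by exists (mpolyC n z) => t; rewrite /peval mevalC. Qed.

Lemma regular_coord i : regular c (fun t => c t 0 i).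
Proof. by exists (mpolyX C (mnm1 i)) => t; rewrite /peval mevalXU. Qed.

Lemma regularD f g : regular c f -> regular c g -> regular c (fun t => f t + g t).
Proof. by move=> [p fp] [q gq]; exists (p + q) => t; rewrite /peval mevalD fp gq. Qed.

Lemma regularM f g : regular c f -> regular c g -> regular c (fun t => f t * g t).
Proof. by move=> [p fp] [q gq]; exists (p * q) => t; rewrite /peval mevalM fp gq. Qed.

Lemma regular_sum I (s : seq I) (P : pred I) (f : I -> T -> C) :
  (forall i, regular c (f i)) -> regular c (fun t => \sum_(i <- s | P i) f i t).
Proof.
move=> fr; elim: s => [|i s IHs].
  by have [p pE] := regular_cst 0; exists p => t; rewrite big_nil -pE.
have [q qE] : regular c (fun t => (if P i then f i t else 0) +
    \sum_(j <- s | P j) f j t).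
  by apply: regularD IHs; case: (P i); [exact: fr|exact: regular_cst].
by exists q => t; rewrite -qE big_cons; case: (P i); rewrite ?add0r.
Qed.

Lemma regular_comp m (d : T -> 'rV[C]_m) f :
  (forall i, regular c (fun t => d t 0 i)) -> regular d f -> regular c f.
Proof.
move=> /choice[q qE] [p pE].
exists (comp_mpoly [tuple q i | i < m] p) => t.
rewrite pE /peval comp_mpoly_meval; apply: meval_eq => i.
by rewrite tnth_mktuple qE.
Qed.

End RegularOps.

Lemma regular_reparam T T' n (c : T -> 'rV[C]_n) (h : T' -> T) f :
  regular c f -> regular (c \o h) (f \o h).
Proof. by move=> [p pE]; exists p => t; rewrite /= pE. Qed.

Lemma peval_continuous n (p : mpoly n C) : continuous (peval p : 'rV[C]_n -> C).
Proof.
elim/mpolyind: p => [|z m p mp z0 IHp].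
  rewrite (_ : peval 0 = fun=> 0); first exact: cst_continuous.
  by apply/funext => v; rewrite /peval meval0.
rewrite (_ : peval (z *: mpolyX C m + p) =
    (fun v : 'rV[C]_n => z * \prod_(i < n) v 0 i ^+ m i) \+ peval p); last first.
  by apply/funext => v; rewrite /peval mevalD mevalZ mevalX.
have FF (v : 'rV[C]_n) := nbhs_filter v.
move=> v; apply: (cvgD (FF := FF v)); last exact: IHp.
apply: (cvgM (FF := FF v)); first exact: cvg_cst.
elim: (index_enum _) => [|i s IHs].
  by rewrite big_nil; under eq_fun do rewrite big_nil; exact: cvg_cst.
rewrite big_cons; under eq_fun do rewrite big_cons.
apply: (cvgM (FF := FF v)) IHs.
elim: (m i) => [|k IHk].
  by rewrite expr0; under eq_fun do rewrite expr0; exact: cvg_cst.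
rewrite exprS; under eq_fun do rewrite exprS.
by apply: (cvgM (FF := FF v)) IHk; exact: coord_continuous.
Qed.

End Regular.

(** * Faithful linear representations *)

Section MaximalMinor.
Variables (F : fieldType) (A B : Type) (h : A -> B -> F).

(** The hypothesis says that the matrix h, with rows indexed by A and columns
    by B, has rank at most #|L|.  An invertible square submatrix M of maximal
    size determines all of h: by maximality, the bordered matrix obtained by
    adding the row x and the column y is singular, so its Schur complement
    h x y - r M^-1 c vanishes. *)
Lemma maximal_minor (L : finType) (u : A -> L -> F) (w : B -> L -> F) :
  (forall a b, h a b = \sum_l u a l * w b l) ->
  exists k (a : 'I_k -> A) (b : 'I_k -> B),
    let M := \matrix_(i, j) h (a i) (b j) in
    M \in unitmx /\
    forall x y, h x y = ((\row_j h x (b j)) *m invmx M *m (\col_i h (a i) y)) 0 0.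
Proof.
move=> huw.
pose P k := `[< exists (a : 'I_k -> A) (b : 'I_k -> B),
  \matrix_(i, j) h (a i) (b j) \in unitmx >].
(* The empty minor is invertible. *)
have P0 : exists k, P k.
  exists 0%N; apply/asboolP.
  have f0 (X : Type) : 'I_0 -> X by case.
  by exists (f0 A), (f0 B); rewrite unitmxE det_mx00 unitr1.
have PN k : P k -> (k <= #|L|)%N.
  move=> /asboolP[a [b]]; rewrite -row_free_unit -row_leq_rank.
  move=> /leq_trans; apply.
  have -> : \matrix_(i, j) h (a i) (b j) =
      (\matrix_(i < k, l < #|L|) u (a i) (enum_val l)) *m
      (\matrix_(l < #|L|, j < k) w (b j) (enum_val l)).
    apply/matrixP => i j; rewrite !mxE huw [LHS]big_enum_val.
    by apply: eq_bigr => l _; rewrite !mxE.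
  exact: leq_trans (mxrankM_maxl _ _) (rank_leq_col _).
have [k /asboolP[a [b Mu]] kmax] := ex_maxnP P0 PN.
exists k, a, b; split=> // x y.
set M := (X in invmx X); set r := \row_j _; set c := \col_i _.
pose s := (h x y)%:M - r *m invmx M *m c : 'M[F]_1.
suff : s == 0.
  rewrite subr_eq0 => /eqP/matrixP/(_ 0 0) <-.
  by rewrite mxE mulr1n.
apply: contraT => s0.
have : P (k + 1)%N.
  apply/asboolP.
  exists (fun i : 'I_(k + 1) => if fintype.split i is inl i' then a i' else x),
         (fun j : 'I_(k + 1) => if fintype.split j is inl j' then b j' else y).
  (* Block elimination: the determinant of the bordered matrix is that of M
     times the entry of s. *)
  rewrite (_ : \matrix_(_, _) _ =
      block_mx 1%:M 0 (r *m invmx M) 1%:M *m block_mx M c 0 s).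
    rewrite unitmxE det_mulmx det_lblock det_ublock !det1 !mul1r det_mx11.
    rewrite unitrM -unitmxE Mu unitfE; apply: contra s0 => /eqP s0.
    by apply/eqP/matrixP => i j; rewrite !ord1 s0 mxE.
  rewrite [RHS]mulmx_block !mul1mx !mul0mx !addr0 mulmxKV //.
  rewrite [_ + s]addrC subrK.
  apply/matrixP => i j; rewrite !mxE.
  case: (fintype.split i) => i'; rewrite !mxE;
    by case: (fintype.split j) => j'; rewrite !mxE ?ord1 ?mulr1n.
by move/kmax; rewrite addn1 ltnn.
Qed.

End MaximalMinor.

Section LinearEmbedding.
Variables (R : realType) (G : groupType) (aG : algebraic_group R G).
Local Notation C := (Cplx R).
Local Notation d := (adim aG).

Section RegularMap.
Variables (T : Type) (n : nat) (c : T -> 'rV[C]_n).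

(** A morphism of algebraic varieties from T, with coordinates c, to G. *)
Definition regular_map (f : T -> G) : Prop :=
  forall j, regular c (fun t => coords aG (f t) 0 j).

Lemma regular_map_cst g : regular_map (fun=> g).
Proof. by move=> j; exact: regular_cst. Qed.

Lemma regular_map_mul f1 f2 :
  regular_map f1 -> regular_map f2 -> regular_map (fun t => f1 t * f2 t)%g.
Proof.
move=> r1 r2 j; have := regular_reparam (fun t => (f1 t, f2 t)) (@mul_regular _ _ aG j).
apply: regular_comp => i /=; rewrite -(splitK i).
by case: (fintype.split i) => i' /=; under eq_fun do rewrite ?row_mxEl ?row_mxEr.
Qed.

Lemma regular_map_inv f : regular_map f -> regular_map (fun t => (f t)^-1)%g.
Proof.
by move=> rf j; have := regular_reparam f (@inv_regular _ _ aG j); apply: regular_comp.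
Qed.

End RegularMap.

(** Each coordinate of x y is a polynomial in the coordinates of x and y;
    splitting its monomials into the part in x and the part in y bounds the
    rank of the matrix (x, (y, j)) |-> (x y)_j. *)
Lemma mul_coords_separated :
  exists (L : finType) (u : G -> L -> C) (w : G * 'I_d -> L -> C),
  forall x b, coords aG (x * b.1)%g 0 b.2 = \sum_l u x l * w b l.
Proof.
have /choice[p pE] := @mul_regular R G aG.
pose k := \max_j msize (p j).
pose mono (x : G) (e : 'I_d -> nat) := \prod_i coords aG x 0 i ^+ e i.
exists (bmultinom (d + d) k).
exists (fun x e => mono x (fun i => bmnm e (lshift d i))).
exists (fun b e => mcoeff (bmnm e) (p b.2) * mono b.1 (fun i => bmnm e (rshift d i))).
move=> x [y j] /=; have /= -> := pE j (x, y).
have /mpolywE pjE : (msize (p j) <= k)%N by exact: (leq_bigmax j).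
rewrite {1}pjE /peval raddf_sum; apply: eq_bigr => e _.
rewrite /= mevalZ mevalX big_split_ord /= mulrCA; apply: f_equal2.
  by apply: eq_bigr => i _; rewrite row_mxEl.
by congr (_ * _); apply: eq_bigr => i _; rewrite row_mxEr.
Qed.

(** The functions x |-> (x (b j).1)_((b j).2) selected by a maximal minor M form
    a basis of the space spanned by all right translates of the coordinate
    functions, and r x is the vector of their values at x.  Right translation
    by g reads r (x g) = r x M^-1 N(g) in this basis, so rho g = M^-1 N(g)
    up to conjugation by M.  An element acting trivially fixes the coordinate
    functions, hence equals 1. *)
Lemma faithful_representation : exists k (rho : G -> 'M[C]_k),
  rational_representation aG rho /\ forall g, rho g = 1%:M -> g = 1%g.
Proof.
have [L [u [w huw]]] := mul_coords_separated.
have [k [a [b]]] := maximal_minor huw.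
set M := \matrix_(i, j) _ => /= -[Mu hM].
pose N g := \matrix_(i, j) coords aG (a i * g * (b j).1)%g 0 (b j).2.
have N1 : N 1%g = M by apply/matrixP => i j; rewrite !mxE mulg1.
pose r x := \row_j coords aG (x * (b j).1)%g 0 (b j).2.
have rN x g : r (x * g)%g = r x *m invmx M *m N g.
  apply/rowP => j; rewrite mxE -mulgA (hM x (g * (b j).1, (b j).2)%g) /= !mxE.
  by apply: eq_bigr => i _; rewrite !mxE mulgA.
have NM g h : N (g * h)%g = N g *m invmx M *m N h.
  apply/row_matrixP => i.
  have rowN x : row i (N x) = r (a i * x)%g by apply/rowP => j; rewrite !mxE.
  by rewrite rowN mulgA rN row_mul row_mul rowN.
exists k, (fun g => N g *m invmx M); split; first split.
- by rewrite N1 mulmxV.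
- by move=> x y; rewrite NM !mulmxA.
- move=> i j.
  under eq_fun do rewrite mxE; apply: regular_sum => l.
  apply: regularM; last exact: regular_cst.
  under eq_fun do rewrite mxE; move: {l}(b l) => [y l] /=.
  apply: regular_map_mul l; last exact: regular_map_cst.
  apply: regular_map_mul; first exact: regular_map_cst.
  by move=> l; exact: regular_coord.
move=> g gM; have {}gM : N g = M by rewrite -[LHS]mulmx1 -(mulVmx Mu) mulmxA gM mul1mx.
have rg : r g = r 1%g by rewrite -[g]mul1g rN gM mulmxKV.
apply: (@coords_inj _ _ aG); apply/rowP => j.
have rE x : coords aG x 0 j = (r x *m invmx M *m \col_i coords aG (a i) 0 j) 0 0.
  have := hM x (1%g, j); rewrite /= mulg1 => ->; rewrite -/(r x).
  by under [X in _ *m X]eq_mx do rewrite mulg1.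
by rewrite rE rg -rE.
Qed.

End LinearEmbedding.

(** * Disconnectedness of the homomorphism variety and of its quotient *)

(** The fiber of f over f a, within A, is closed, and also open because V minus
    f a is finite, hence closed. *)
Lemma disconnected_finite_valued (X Y : topologicalType) (A : set X)
    (f : X -> Y) (V : set Y) a b :
  accessible_space Y -> finite_set V -> continuous f -> f @` A `<=` V ->
  A a -> A b -> f a <> f b -> ~ connected A.
Proof.
move=> /accessible_finite_set_closed accY finV cf AV Aa Ab fab cA.
have closedV W : W `<=` V -> closed W by move=> WV; apply: accY; exact: sub_finite_set finV.
have /continuousP openf := cf; have /continuous_closedP closedf := cf.
pose B := A `&` f @^-1` [set f a].
suff BA : B = A by move: Ab; rewrite -BA => -[_ /= /esym].
apply: cA; first by exists a.
- exists (f @^-1` (~` (V `\ f a))).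
    by apply/openf; rewrite openC; apply: closedV => ? [].
  apply/seteqP; split=> x [Ax /= fx]; split=> //=; first by rewrite fx => -[_].
  by apply: contrapT => fxa; apply: fx; split=> //; apply: AV; exists x.
- exists (f @^-1` [set f a]) => //; apply: closedf.
  by apply: closedV => z /= ->; apply: AV; exists a.
Qed.

(** Stated for a mere type I; the alias {classic I} provides the decidable
    equality that [proj_continuous] asks of the index type. *)
Lemma eval_ptws_continuous (I : Type) (Y : topologicalType) (i : I) :
  continuous (fun f : {ptws I -> Y} => f i).
Proof. exact: (@proj_continuous {classic I} (fun=> Y) i). Qed.

Section GroupHom.
Variables (Gamma G : groupType) (phi : {multiplicative Gamma -> G}).

(** Morphisms are given here as maps compatible with products only; that they
    preserve 1 and inverses follows since they relate groups. *)
Lemma hom1 : phi 1%g = 1%g.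
Proof. by apply: (mulgI (phi 1%g)); rewrite -gmulfM !mulg1. Qed.

Lemma homV x : phi x^-1%g = (phi x)^-1%g.
Proof. by apply: (mulgI (phi x)); rewrite -gmulfM !mulgV hom1. Qed.

Lemma homR x y : phi [~ x, y]%g = [~ phi x, phi y]%g.
Proof. by rewrite !commgEl !conjgE !gmulfM !homV. Qed.

End GroupHom.

Section HomVariety.
Variables (R : realType) (G : groupType) (aG : algebraic_group R G).
Variables (Gamma : groupType) (r : nat) (s : 'I_r -> Gamma).
Hypothesis gen_s : generated (range s) = setT.
Local Notation C := (Cplx R).
Local Notation Hom := {multiplicative Gamma -> G}.

Lemma regular_map_eval x : regular_map aG (hom_coords aG s) (fun phi : Hom => phi x).
Proof.
have : generated (range s) x by rewrite gen_s.
move: x; apply: smallest_sub => [|_ [i _ <-]] /=; last first.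
  move=> j; have := regular_coord (hom_coords aG s) (mxvec_index i j).
  by under eq_fun do rewrite /hom_coords mxvecE mxE.
split.
  apply/mem_set => /=.
  rewrite (_ : (fun phi : Hom => _) = fun=> 1%g); first exact: regular_map_cst.
  by apply/funext => phi; rewrite hom1.
move=> x y /set_mem /= rx /set_mem /= ry; apply/mem_set => /=.
rewrite (_ : (fun phi : Hom => _) = fun phi => (phi x * (phi y)^-1)%g).
  by apply: regular_map_mul => //; exact: regular_map_inv.
by apply/funext => phi; rewrite gmulfM homV.
Qed.

Section TraceFunction.
Variables (k : nat) (rho : G -> 'M[C]_k).
Hypothesis rho_rat : rational_representation aG rho.

Lemma trace_invariant_regular x :
  invariant_regular aG s (fun phi : Hom => \tr (rho (phi x))).
Proof.
case: rho_rat => rho1 rhoM rho_reg; split.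
  apply: regular_sum => i.
  have := regular_reparam (fun phi : Hom => phi x) (rho_reg i i).
  apply: regular_comp.
  exact: regular_map_eval.
move=> g phi; rewrite /= /conj_fun !rhoM mxtrace_mulC mulmxA -rhoM mulVg.
by rewrite rho1 mul1mx.
Qed.

Lemma mx_rep_comp (phi : Hom) : mx_rep (fun x => rho (phi x)).
Proof.
by case: rho_rat => rho1 rhoM _; split=> [|x y]; rewrite ?hom1 ?gmulfM.
Qed.

End TraceFunction.

Local Notation Inv := (invariant_ring aG s).

Definition eval_char (phi : Hom) : {ptws Inv -> C} := fun f : Inv => sval f phi.

Lemma eval_char_git phi : git_quotient aG s (eval_char phi).
Proof. by split=> [a b c cE|a b c cE|z c cE]; exact: cE. Qed.

(** The product of the f - z, for z in V, is the zero function, so its image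
    under the morphism of algebras chi is 0: chi f is one of the z. *)
Lemma git_quotient_spectrum (chi : {ptws Inv -> C}) (f : Inv) (V : seq C) :
  git_quotient aG s chi -> (forall phi, sval f phi \in V) -> chi f \in V.
Proof.
case=> chiD chiM chiC fV.
have cstP z : invariant_regular aG s (fun=> z) by split=> //; exact: regular_cst.
have addP (a b : Inv) : invariant_regular aG s (fun phi => sval a phi + sval b phi).
  case: a b => [a [ra ia]] [b [rb ib]]; split=> [|g phi] /=; first exact: regularD.
  by rewrite ia ib.
have mulP (a b : Inv) : invariant_regular aG s (fun phi => sval a phi * sval b phi).
  case: a b => [a [ra ia]] [b [rb ib]]; split=> [|g phi] /=; first exact: regularM.
  by rewrite ia ib.
have [q [qE chiq]] : exists q : Inv,
    (forall phi, sval q phi = \prod_(z <- V) (sval f phi - z)) /\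
    chi q = \prod_(z <- V) (chi f - z).
  elim: V {fV} => [|z V [q [qE chiq]]].
    exists (exist _ _ (cstP 1)); split=> [phi|]; rewrite big_nil //.
    exact: chiC.
  pose cz : Inv := exist _ _ (cstP (- z)).
  pose fz : Inv := exist _ _ (addP f cz).
  exists (exist _ _ (mulP fz q)); split=> [phi|].
    by rewrite big_cons -qE.
  rewrite big_cons -chiq -(chiC (- z) cz) // -(chiD f cz fz) //.
  exact: (chiM fz q).
have : \prod_(z <- V) (chi f - z) = 0.
  rewrite -chiq; apply: chiC => phi; rewrite qE; apply/eqP.
  by rewrite prodf_seq_eq0; apply/hasP; exists (sval f phi); rewrite //= subrr.
move/eqP; rewrite prodf_seq_eq0 => /hasP[z zV /=].
by rewrite subr_eq0 => /eqP ->.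
Qed.

Lemma disconnected_of_invariant (f : Inv) (V : seq C) (phi psi : Hom) :
  (forall theta, sval f theta \in V) -> sval f phi <> sval f psi ->
  ~ connected (hom_variety aG s) /\ ~ connected (git_quotient aG s).
Proof.
have accC : accessible_space C by apply: hausdorff_accessible; exact: norm_hausdorff.
have finV : finite_set [set` V] by exact: finite_seq.
move=> fV fpq; split.
  have [[p pE] _] := svalP f.
  apply: (disconnected_finite_valued (f := peval p) (V := [set` V])
    (a := hom_coords aG s phi) (b := hom_coords aG s psi)) => //.
  - exact: peval_continuous.
  - by move=> _ [_ [theta _ <-] <-]; rewrite -pE /=.
  - by exists phi.
  - by exists psi.
  - by rewrite -!pE.
apply: (disconnected_finite_valued (f := fun chi : {ptws Inv -> C} => chi f)
    (V := [set` V]) (a := eval_char phi) (b := eval_char psi)) => //.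
- exact: eval_ptws_continuous.
- by move=> _ [chi chiP <-] /=; exact: git_quotient_spectrum.
- exact: eval_char_git.
- exact: eval_char_git.
Qed.

End HomVariety.

(** Two powers of g coincide, F being finite. *)
Lemma finite_subgroup_exponent (G : groupType) (F : set G) g :
  subgroup F -> finite_set F -> F g -> exists2 N, (0 < N)%N & (g ^+ N = 1)%g.
Proof.
move=> sF finF Fg.
have FX k : F (g ^+ k)%g by exact: subgroupX.
have : ~ {in [set: nat] &, injective (fun k => g ^+ k)%g}.
  move=> inj; apply: infinite_nat.
  have /card_eqPle[_ cle] := inj_card_eq inj.
  apply: card_le_finite cle _; apply: sub_finite_set finF.
  by move=> _ [k _ <-].
move=> /existsNP[i /existsNP[j /not_implyP[_ /not_implyP[_ /not_implyP[gij ij]]]]].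
wlog ltij : i j gij ij / (i < j)%N => [wl|].
  case: (ltngtP i j) => [|ji|/ij//]; first exact: wl.
  by apply: (wl j i) => // /esym.
exists (j - i)%N; first by rewrite subn_gt0.
by rewrite expgnFr ?(ltnW ltij) // -gij mulgV.
Qed.

Theorem theorem1p5 (R : realType) (G : groupType) (aG : algebraic_group R G)
    (Gamma : groupType) (r : nat) (s : 'I_r -> Gamma) :
  reductive aG ->
  generated (range s) = setT ->
  nilpotent_group Gamma ->
  (exists (F : set G) (phi : {multiplicative Gamma -> G}),
    [/\ subgroup F, finite_set F, ~ abelian_subset F & range phi = F]) ->
  ~ connected (hom_variety aG s) /\ ~ connected (git_quotient aG s).
Proof.
move=> _ gen_s [c lc] [F [phi [sF finF nabF phiF]]].
have [x [y phixy]] : exists x y, ~ commute (phi x) (phi y).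
  apply: contrapT => /forallNP comm; apply: nabF => u v.
  rewrite -phiF => -[x _ <-] [y _ <-].
  by apply: contrapT => nc; apply: (comm x); exists y.
pose g := [~ x, y]%g.
have lg : lower_central 1 g by apply: sub_gen_smallest; exists x, y.
have phig : phi g <> 1%g by rewrite homR => /eqP/commgP.
have [N N0 gN] : exists2 N, (0 < N)%N & (phi g ^+ N = 1)%g.
  by apply: finite_subgroup_exponent sF finF _; rewrite -phiF; exists g.
have [k [rho [rho_rat rho_inj]]] := faithful_representation aG.
have [V VP] := trace_commutator_finite (Cplx R) k lc lg.
pose f : invariant_ring aG s := exist _ _ (trace_invariant_regular gen_s rho_rat g).
pose triv : {multiplicative Gamma -> G} := one_fun (T := Gamma) G.
apply: (disconnected_of_invariant (f := f) (V := V) (phi := phi) (psi := triv)).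
  move=> theta; exact: VP (mx_rep_comp rho_rat theta).
have [rho1 rhoM _] := rho_rat.
rewrite /= rho1 mxtrace1 => trg; apply/phig/rho_inj.
apply: (@trace_finite_order (Cplx R) _ _ _ N0 _ trg).
have rhoX m : rho (phi g) ^+ m = rho (phi g ^+ m)%g.
  by elim: m => [|m IHm]; rewrite ?expg0 ?rho1 // expgS rhoM exprS IHm.
by rewrite rhoX gN.
Qed.
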